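(* Let $G$ be a triangle-free graph with diameter $2$ and (vertex) connectivity $\kappa(G)=g\ge 1$. Then $\chi(G)\le g+1$. Furthermore, this bound is best possible.
   Context: All graphs are finite and simple. The diameter of a graph is the maximum graph distance between two of its vertices. $\chi(G)$ denotes the chromatic number and $\kappa(G)$ the vertex connectivity of $G$. *)

(* Defs.v *)
From mathcomp Require Import all_boot.

Set Implicit Arguments.
Unset Strict Implicit.
Unset Printing Implicit Defensive.

Record sgraph := SGraph {
  vertex :> finType;
  adj : rel vertex;
  adj_sym : symmetric adj;
  adj_irrefl : irreflexive adj
}.

Section GraphInvariants.
Variable G : sgraph.
Implicit Types (x y z : G) (S : {set G}).

Definition triangle_free : Prop :=
  ~ exists x y z, [/\ adj x y, adj y z & adj z x].

Definition walk (k : nat) x y : Prop :=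
  exists p : seq G, [/\ size p = k, path (@adj G) x p & last x p = y].

(* Distance is a relation: no [k] is the distance between vertices lying in
   different components (infinite distance). *)
Definition is_dist x y (k : nat) : Prop :=
  walk k x y /\ forall j, walk j x y -> k <= j.

(* The distances are all finite, and [d] is their maximum; in particular a
   disconnected graph has no diameter in this sense. *)
Definition has_diameter (d : nat) : Prop :=
  (forall x y, exists2 k, is_dist x y k & k <= d) /\
  (exists x y, is_dist x y d).

Definition proper_coloring (k : nat) (c : {ffun G -> 'I_k}) : bool :=
  [forall x, forall y, adj x y ==> (c x != c y)].

Definition colorable (k : nat) : bool :=
  [exists c : {ffun G -> 'I_k}, proper_coloring c].

Lemma colorable_card : exists k, colorable k.
Proof.
exists #|G|; apply/existsP; exists [ffun x => enum_rank x].
apply/forallP => x; apply/forallP => y; apply/implyP => xy.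
rewrite !ffunE; apply/eqP => /enum_rank_inj eq_xy.
by rewrite eq_xy adj_irrefl in xy.
Qed.

Definition chromatic_number : nat := ex_minn colorable_card.

Definition adj_outside S : rel G :=
  [rel x y | [&& x \notin S, y \notin S & adj x y]].

Definition disconnects S : bool :=
  [exists x in ~: S, exists y in ~: S, ~~ connect (adj_outside S) x y].

(* The minimum size of a set [S] such that [G - S] is disconnected or has at
   most one vertex, so that complete graphs on n >= 1 vertices have
   connectivity n - 1. The base point [setT] of the minimisation always
   qualifies. *)
Definition connectivity : nat :=
  #|[arg min_(S < [set: G] | disconnects S || (#|~: S| <= 1)) #|S|]|.

End GraphInvariants.

(* Main.v *)
Require Import Defs.
From mathcomp Require Import all_boot.

Set Implicit Arguments.
Unset Strict Implicit.
Unset Printing Implicit Defensive.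

(** Upper bound: let S be a minimum cut.  Two vertices in different components
of G - S have a common neighbour, which lies in S, so S dominates its
complement.  The neighbourhoods of the vertices of S are independent, and the
vertices with no neighbour in S all lie in S and hence are independent: this
is a colouring with |S| + 1 colours.

Sharpness: the Mycielskian preserves being triangle-free of diameter 2, and
increases both the chromatic number and the minimum degree by one.  Iterate it
from the path on three vertices.  Since connectivity <= degree and
chi <= connectivity + 1, a vertex of degree g and chi >= g + 1 already force
the exact values of the connectivity and of chi. *)

(** * Colourings and the chromatic number *)

Section Coloring.
Variable G : sgraph.
Implicit Types (x y z : G) (S : {set G}).

Lemma colorable_finType (T : finType) (c : G -> T) (k : nat) :
  #|T| <= k -> (forall x y, adj x y -> c x != c y) -> colorable G k.
Proof.
move=> leTk c_proper; apply/existsP.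
exists [ffun x => widen_ord leTk (enum_rank (c x))].
apply/forallP=> x; apply/forallP=> y; apply/implyP=> /c_proper.
apply: contra_neq; rewrite !ffunE => /(congr1 val) /= /val_inj.
exact: enum_rank_inj.
Qed.

Lemma chromatic_number_le (k : nat) : colorable G k -> chromatic_number G <= k.
Proof. by rewrite /chromatic_number; case: ex_minnP => m _; apply. Qed.

Lemma colorable_chromatic_number : colorable G (chromatic_number G).
Proof. by rewrite /chromatic_number; case: ex_minnP. Qed.

Lemma colorableP (k : nat) :
  reflect (exists c : G -> 'I_k, forall x y, adj x y -> c x != c y)
          (colorable G k).
Proof.
apply: (iffP existsP) => [[c /forallP c_proper]|[c c_proper]].
  by exists c => x y xy; move/forallP/(_ y)/implyP: (c_proper x); apply.
exists (finfun c); apply/forallP=> x; apply/forallP=> y; apply/implyP=> xy.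
by rewrite !ffunE c_proper.
Qed.

End Coloring.

(** * Diameter two expressed through adjacency instead of walks *)

Lemma has_diameter2P (G : sgraph) :
  has_diameter G 2 <->
  (forall x y : G, [\/ x = y, adj x y | exists2 z, adj x z & adj z y]) /\
  (exists x y : G, x != y /\ ~~ adj x y).
Proof.
split=> [[dist_le2 [x [y [_ dist_ge2]]]]|[near [x [y [neq_xy nadj_xy]]]]].
  split=> [u v|].
    case: (dist_le2 u v) => k [[p [<- pth <-]] _].
    case: p pth => [|a [|b [|]]] //=; first by constructor 1.
      by rewrite andbT; constructor 2.
    by rewrite andbT => /andP[ua ab] _; constructor 3; exists a.
  exists x, y; split; apply/negP.
    by move=> /eqP eq_xy; have /dist_ge2 : walk 0 x y by exists [::].
  move=> adj_xy; have /dist_ge2 // : walk 1 x y.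
  by exists [:: y]; rewrite /= adj_xy.
have dist0 (u : G) : is_dist u u 0 by split; first exists [::].
have dist1 (u v : G) : u != v -> adj u v -> is_dist u v 1.
  move=> neq_uv uv; split; first by exists [:: v]; rewrite /= uv.
  by case=> // -[[|a p] [] //= _ _ /eqP]; rewrite (negPf neq_uv).
have dist2 (u v z : G) :
    u != v -> ~~ adj u v -> adj u z -> adj z v -> is_dist u v 2.
  move=> neq_uv nuv uz zv; split; first by exists [:: z; v]; rewrite /= uz zv.
  case=> [|[|//]] [[|a [|b p]] [] //= _].
    by move=> _ /eqP; rewrite (negPf neq_uv).
  by rewrite andbT => ua eq_av; rewrite -eq_av ua in nuv.
split=> [u v|].
  have [->|neq_uv] := eqVneq u v; first by exists 0.
  have [uv|nuv] := boolP (adj u v); first by exists 1 => //; apply: dist1.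
  case: (near u v) => [/eqP||[z uz zv]]; rewrite ?(negPf neq_uv) ?(negPf nuv) //.
  by exists 2 => //; apply: (dist2 _ _ z).
exists x, y; case: (near x y) => [/eqP||[z xz zy]].
- by rewrite (negPf neq_xy).
- by rewrite (negPf nadj_xy).
- exact: (dist2 _ _ z).
Qed.

(** * Connectivity, dominating cuts and the upper bound *)

Section Connectivity.
Variable G : sgraph.
Implicit Types (x y z : G) (S : {set G}).

Lemma connectivityP :
  exists2 S : {set G}, disconnects S || (#|~: S| <= 1) & #|S| = connectivity G.
Proof.
rewrite /connectivity; case: arg_minnP => [|S S_sep _]; last by exists S.
by rewrite setCT cards0 orbT.
Qed.

Lemma connectivity_le S :
  disconnects S || (#|~: S| <= 1) -> connectivity G <= #|S|.
Proof.
rewrite /connectivity; case: arg_minnP => [|T _]; last by apply.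
by rewrite setCT cards0 orbT.
Qed.

(** Deleting the neighbourhood of [x] isolates [x]: either another vertex survives and is cut off
    from it, or at most one vertex is left. *)
Lemma connectivity_le_degree x : connectivity G <= #|[set y | adj x y]|.
Proof.
apply: connectivity_le; set S := [set y | _].
have xS : x \notin S by rewrite inE adj_irrefl.
have [_|/card_gt1P [a [b [aS bS neq_ab]]]] := leqP #|~: S| 1.
  by rewrite orbT.
have [y yS neq_xy] : exists2 y, y \in ~: S & x != y.
  have [eq_xa|] := eqVneq x a; last by exists a.
  by exists b; rewrite // eq_xa.
apply/orP; left; apply/exists_inP; exists x; first by rewrite inE.
apply/exists_inP; exists y => //; apply/negP => /connectP[[|z p] /=].
  by move=> _ eq_yx; rewrite eq_yx eqxx in neq_xy.
have zS : (z \in S) = adj x z by rewrite inE.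
by rewrite /adj_outside /= zS; case: (adj x z); rewrite /= ?andbF.
Qed.

Lemma disconnects_dominating S x :
  has_diameter G 2 -> disconnects S -> x \notin S ->
  exists2 s, s \in S & adj s x.
Proof.
move=> /has_diameter2P[near _] /exists_inP[a aS /exists_inP[b bS nab]] xS.
(* [x] cannot reach both [a] and [b], which are separated by [S]. A common neighbour of [x] and an
   unreachable [y] must then lie in [S]. *)
have [y yS nxy] : exists2 y, y \notin S & ~~ connect (adj_outside S) x y.
  rewrite !inE in aS bS.
  have [xa|nxa] := boolP (connect (adj_outside S) x a); last by exists a.
  exists b => //; apply: contra nab; apply: connect_trans.
  rewrite sym_connect_sym // => u v.
  by rewrite /adj_outside /= adj_sym andbCA.
case: (near x y) => [eq_xy|xy|[z xz zy]].
- by rewrite eq_xy connect0 in nxy.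
- by case/negP: nxy; apply: connect1; rewrite /adj_outside /= xS yS xy.
exists z; last by rewrite adj_sym.
apply: contraR nxy => zS.
by apply: (@connect_trans _ _ z); apply: connect1;
   rewrite /adj_outside /= ?xS ?yS zS ?xz ?zy.
Qed.

Lemma colorable_dominating S :
  triangle_free G -> (forall x, x \notin S -> exists2 s, s \in S & adj s x) ->
  colorable G #|S|.+1.
Proof.
move=> noK3 domS.
(* The colour is a chosen neighbour in [S], and [None] if there is none. Adjacent vertices sharing a
   neighbour [s] would form a triangle with it; adjacent vertices coloured [None] would both lie in
   [S], each being a neighbour in [S] of the other. *)
pose c x : option {s | s \in S} := [pick s | adj (val s) x].
apply: (@colorable_finType _ _ c) => [|x y xy].
  by rewrite card_option card_sig.
apply/eqP; rewrite /c; case: pickP => [s sx|nx].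
  case: pickP => // t ty [eq_st]; rewrite -eq_st in ty.
  by case: noK3; exists (val s), x, y; rewrite [adj y _]adj_sym.
case: pickP => // ny _.
have inS z : (forall s : {s | s \in S}, adj (val s) z = false) -> z \in S.
  move=> nz; apply/negPn/negP => /domS[s sS sz].
  by have := nz (exist _ s sS); rewrite /= sz.
by have := ny (exist _ x (inS x nx)); rewrite /= xy.
Qed.

Lemma chromatic_number_le_connectivity :
  triangle_free G -> has_diameter G 2 ->
  chromatic_number G <= (connectivity G).+1.
Proof.
move=> noK3 diam2; have [S Ssep <-] := connectivityP.
apply: chromatic_number_le; case/orP: Ssep => [disS|small].
  by apply: colorable_dominating => // x; apply: disconnects_dominating.
(* Degenerate cut: the graph has at most [#|S|.+1] vertices, so all of them can receive distinct
   colours. *)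
apply: (@colorable_finType _ _ id) => [|x y xy].
  by rewrite -(cardsC S) -addn1 leq_add2l.
by apply: contraTneq xy => ->; rewrite adj_irrefl.
Qed.

End Connectivity.

(** * The Mycielskian: triangles, diameter, degree and colourings *)

Section Mycielskian.
Variable G : sgraph.

(* [Some (inl x)] is the vertex [x] of [G], [Some (inr x)] its shadow, and
   [None] the apex joined to all shadows. *)
Definition mycielski_adj (a b : option (G + G)) : bool :=
  match a, b with
  | Some (inl x), Some (inl y) | Some (inl x), Some (inr y)
  | Some (inr x), Some (inl y) => adj x y
  | Some (inr _), None | None, Some (inr _) => true
  | _, _ => false
  end.

Lemma mycielski_adj_sym : symmetric mycielski_adj.
Proof. by move=> [[x|x]|] [[y|y]|] //=; rewrite adj_sym. Qed.

Lemma mycielski_adj_irrefl : irreflexive mycielski_adj.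
Proof. by move=> [[x|x]|] //=; rewrite adj_irrefl. Qed.

Definition mycielskian : sgraph :=
  SGraph mycielski_adj_sym mycielski_adj_irrefl.

Lemma mycielskian_triangle_free : triangle_free G -> triangle_free mycielskian.
Proof.
move=> noK3 [[[x|x]|] [[[y|y]|] [[[z|z]|] []]]] //= xy yz zx;
  by apply: noK3; exists x, y, z.
Qed.

Lemma mycielskian_diameter2 : has_diameter G 2 -> has_diameter mycielskian 2.
Proof.
move=> /has_diameter2P[near [x0 [y0 [neq0 nadj0]]]].
have nbr (x : G) : exists y, adj x y.
  have [y neq_xy] : exists y, x != y.
    have [eq_x|] := eqVneq x x0; last by exists x0.
    by exists y0; rewrite eq_x.
  case: (near x y) => [/eqP||[z xz _]]; first by rewrite (negPf neq_xy).
    by exists y.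
  by exists z.
(* The case [x = y] is included because a vertex and its own shadow are distinct and nonadjacent;
   any neighbour of [x] joins them. *)
have common (x y : G) : adj x y \/ exists2 z, adj x z & adj z y.
  case: (near x y) => [<-|xy|[z xz zy]]; [right|by left|by right; exists z].
  by have [z xz] := nbr x; exists z; rewrite // adj_sym.
apply/has_diameter2P; split; last by exists (Some (inl x0)), None.
move=> [[x|x]|] [[y|y]|].
- case: (near x y) => [->|xy|[z xz zy]]; [by constructor 1|by constructor 2|].
  by constructor 3; exists (Some (inl z)).
- case: (common x y) => [xy|[z xz zy]]; first by constructor 2.
  by constructor 3; exists (Some (inl z)).
- by constructor 3; have [z xz] := nbr x; exists (Some (inr z)).
- case: (common x y) => [xy|[z xz zy]]; first by constructor 2.
  by constructor 3; exists (Some (inl z)).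
- by constructor 3; exists None.
- by constructor 2.
- have [z yz] := nbr y.
  by constructor 3; exists (Some (inr z)); rewrite //= adj_sym.
- by constructor 2.
- by constructor 1.
Qed.

Lemma mycielskian_degree (x : G) :
  #|[set b | adj (Some (inr x) : mycielskian) b]| = #|[set y | adj x y]|.+1.
Proof.
have -> : [set b | adj (Some (inr x) : mycielskian) b]
    = None |: [set Some (inl y) | y in [set y | adj x y]].
  apply/setP=> -[[y|y]|]; rewrite !inE //=.
    by rewrite (mem_imset (f := fun y => Some (inl y))) ?inE // => u v [].
  by apply/esym/negbTE/imsetP => -[].
rewrite cardsU1 card_imset => [|y z [] //].
by case: imsetP => [[]|].
Qed.

Lemma mycielskian_colorable (k : nat) :
  colorable mycielskian k.+1 -> colorable G k.
Proof.
case/colorableP=> c c_proper; pose m := c None.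
have shadow_neq (x : G) : c (Some (inr x)) != m by apply: c_proper.
(* The apex colour [m] is removed by recolouring with the colours of shadows. *)
pose c' (x : G) :=
  if c (Some (inl x)) == m then c (Some (inr x)) else c (Some (inl x)).
have c'P (x : G) : c' x \in predC1 m.
  by rewrite inE /= /c'; case: ifPn => // _; apply: shadow_neq.
pose T : finType := {i | i \in predC1 m}.
pose c'' (x : G) : T := exist _ (c' x) (c'P x).
apply: (@colorable_finType G T c'').
  by rewrite card_sig cardC1 card_ord.
move=> x y xy; rewrite -val_eqE /= /c'.
(* If only one end is recoloured, its shadow is still adjacent to the other end; both cannot have
   colour [m], since they are adjacent. *)
case: ifP => [/eqP xm|_]; case: ifP => [/eqP ym|_]; try exact: c_proper.
by have := c_proper (Some (inl x)) (Some (inl y)) xy; rewrite xm ym eqxx.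
Qed.

End Mycielskian.

(** * Base graph: the path on three vertices, with [None] as its midpoint *)

Definition path3_adj (a b : option bool) : bool := isSome a (+) isSome b.

Lemma path3_adj_sym : symmetric path3_adj.
Proof. by move=> a b; apply: addbC. Qed.

Lemma path3_adj_irrefl : irreflexive path3_adj.
Proof. by move=> a; apply: addbb. Qed.

Definition path3 : sgraph := SGraph path3_adj_sym path3_adj_irrefl.

Lemma path3_triangle_free : triangle_free path3.
Proof. by move=> [[[]|] [[[]|] [[[]|] []]]]. Qed.

Lemma path3_diameter2 : has_diameter path3 2.
Proof.
apply/has_diameter2P; split; last by exists (Some true), (Some false).
move=> [a|] [b|]; [|by constructor 2|by constructor 2|by constructor 1].
by constructor 3; exists None.
Qed.

Lemma path3_degree : #|[set b | adj (Some true : path3) b]| = 1.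
Proof.
by rewrite -(cards1 (None : path3)); apply: eq_card => -[b|]; rewrite !inE.
Qed.

Lemma path3_chromatic_number : 1 < chromatic_number path3.
Proof.
have /colorableP[c c_proper] := colorable_chromatic_number path3.
have := c_proper (Some true) None isT.
case: (chromatic_number path3) c {c_proper} => [|[|//]] c.
  by case: (c None).
by rewrite !ord1.
Qed.

(** * Iterated Mycielskians and sharpness of the bound *)

Lemma mycielski_tower (g : nat) :
  exists G : sgraph,
    [/\ triangle_free G, has_diameter G 2,
        exists x : G, #|[set y | adj x y]| = g.+1
      & g.+1 < chromatic_number G].
Proof.
elim: g => [|g [G [noK3 diam2 [x deg_x] chi]]].
  exists path3; split; [exact: path3_triangle_free|exact: path3_diameter2| |].
    by exists (Some true); apply: path3_degree.
  exact: path3_chromatic_number.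
exists (mycielskian G); split.
- exact: mycielskian_triangle_free.
- exact: mycielskian_diameter2.
- by exists (Some (inr x)); rewrite mycielskian_degree deg_x.
have := colorable_chromatic_number (mycielskian G).
case: (chromatic_number _) => [|k /mycielskian_colorable/chromatic_number_le].
  by case/colorableP=> c; case: (c None).
exact: leq_trans chi.
Qed.

Theorem theorem5 :
  (forall (G : sgraph) (g : nat),
     triangle_free G -> has_diameter G 2 -> connectivity G = g -> 1 <= g ->
     chromatic_number G <= g.+1)
  /\
  (forall g : nat, 1 <= g ->
     exists G : sgraph,
       [/\ triangle_free G, has_diameter G 2, connectivity G = g
         & chromatic_number G = g.+1]).
Proof.
split=> [G g noK3 diam2 <- _|[//|g] _].
  exact: chromatic_number_le_connectivity.
have [G [noK3 diam2 [x deg_x] chi]] := mycielski_tower g.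
have chi_le := chromatic_number_le_connectivity noK3 diam2.
have conn_le : connectivity G <= g.+1 by rewrite -deg_x connectivity_le_degree.
(* In [g.+1 < chromatic_number G <= (connectivity G).+1 <= g.+2] the outer bounds force equality in
   every link. *)
exists G; split=> //; apply/eqP; rewrite eqn_leq.
  by rewrite conn_le -ltnS (leq_trans chi).
by rewrite chi (leq_trans chi_le).
Qed.
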